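(* Let $n\ge 2$, $V=\{1,\dots,n\}$, let $\widetilde f=(\widetilde f_1,\dots,\widetilde f_n)$ be a vector of fuzzy sets over a universe $U\subset\mathbb{R}^+$, let $D:F(\mathbb{R}^+)\to\mathbb{R}^+$ be a defuzzification operator, and let $p\in(0,1)$. Then the set function $\mu_{f,p}:2^V\to\mathbb{R}$ built from $\widetilde f$, $D$ and $p$ is a fuzzy Sugeno $\lambda$-measure (that is, a fuzzy measure satisfying the Sugeno $\lambda$-rule).
   Context: $\mathbb{R}^+$ denotes the positive real numbers. A fuzzy set on $\mathbb{R}^+$ is given by a membership function $\mathbb{R}^+\to[0,1]$; $F(\mathbb{R}^+)$ is the collection of all fuzzy sets on $\mathbb{R}^+$. A fuzzy set $\widetilde f_i$ over $U\subset\mathbb{R}^+$, with membership function $\eta_{f_i}:U\to[0,1]$, is regarded as a fuzzy set on $\mathbb{R}^+$ (membership $0$ outside $U$). A defuzzification operator is any map $D:F(\mathbb{R}^+)\to\mathbb{R}^+$. Definition of $\mu_{f,p}$ for $p\in(0,1]$. On singletons, $$\mu_{f,p}(i)=\mu_{f,p}(\{i\})=\frac{p\,D(\widetilde f_i)}{\sum_{k=1}^n D(\widetilde f_k)},\qquad i\in V.$$ Let $\lambda\in(-1,\infty)$ be a solution of $\lambda+1=\prod_{i=1}^n(1+\lambda\mu_{f,p}(i))$, where, as usual for Sugeno measures, $\lambda$ is taken to be a nonzero solution in $(-1,\infty)$ if one exists, and $\lambda=0$ otherwise. Then $\mu_{f,p}:2^V\to\mathbb{R}$ is the set function with these singleton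 values that satisfies $$\mu_{f,p}(M\cup N)=\mu_{f,p}(M)+\mu_{f,p}(N)+\lambda\,\mu_{f,p}(M)\mu_{f,p}(N)\qquad\text{for all } M,N\subseteq V \text{ with } M\cap N=\emptyset .$$ A fuzzy measure on $V$ is a set function $\mu:2^V\to[0,1]$ with $\mu(\emptyset)=0$, $\mu(V)=1$, and $\mu(M)\le\mu(N)$ whenever $M\subseteq N\subseteq V$. A (fuzzy) Sugeno $\lambda$-measure is a fuzzy measure $\mu$ for which there is $\lambda\in(-1,\infty)$ with $\mu(M\cup N)=\mu(M)+\mu(N)+\lambda\mu(M)\mu(N)$ for all disjoint $M,N\subseteq V$. *)

(* Defs.v *)
From HB Require Import structures.
From mathcomp Require Import all_boot all_order all_algebra.
From mathcomp Require Import all_classical all_reals interval_inference.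

Set Implicit Arguments.
Unset Strict Implicit.
Unset Printing Implicit Defensive.

Import Order.TTheory GRing.Theory Num.Theory.
Local Open Scope classical_set_scope.
Local Open Scope ring_scope.

Definition fuzzy_set (R : realType) : Type := {posnum R} -> {i01 R}.

(* A fuzzy set over the universe U, seen as a fuzzy set on the positive reals
   with membership 0 outside U. *)
Definition extend_fuzzy (R : realType) (U : set {posnum R})
    (eta : U -> {i01 R}) : fuzzy_set R :=
  'valL_(0%:i01) eta.

Definition defuzzification (R : realType) : Type := fuzzy_set R -> {posnum R}.

(* The ground set V = {1, ..., n} is represented by 'I_n, and 2^V by
   {set 'I_n}. *)

Definition fuzzy_measure (R : realType) (n : nat) (mu : {set 'I_n} -> R) :
    Prop :=
  [/\ forall M : {set 'I_n}, 0 <= mu M <= 1,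
      mu finset.set0 = 0,
      mu [set: 'I_n]%SET = 1 &
      forall M N : {set 'I_n}, M \subset N -> mu M <= mu N].

Definition sugeno_rule (R : realType) (n : nat) (lambda : R)
    (mu : {set 'I_n} -> R) : Prop :=
  forall M N : {set 'I_n}, M :&: N = finset.set0 ->
    mu (M :|: N) = mu M + mu N + lambda * mu M * mu N.

Definition sugeno_lambda_measure (R : realType) (n : nat)
    (mu : {set 'I_n} -> R) : Prop :=
  fuzzy_measure mu /\ exists lambda : R, -1 < lambda /\ sugeno_rule lambda mu.

Definition mu_singleton (R : realType) (n : nat) (f : 'I_n -> fuzzy_set R)
    (D : defuzzification R) (p : R) (i : 'I_n) : R :=
  p * (D (f i))%:num / \sum_(k < n) (D (f k))%:num.

Definition lambda_solution (R : realType) (n : nat) (f : 'I_n -> fuzzy_set R)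
    (D : defuzzification R) (p lambda : R) : Prop :=
  -1 < lambda /\
  lambda + 1 = \prod_(i < n) (1 + lambda * mu_singleton f D p i).

(* The solution 0, which always exists, is admitted only when there is no
   nonzero one. *)
Definition sugeno_parameter (R : realType) (n : nat) (f : 'I_n -> fuzzy_set R)
    (D : defuzzification R) (p lambda : R) : Prop :=
  lambda_solution f D p lambda /\
  (lambda = 0 -> forall l : R, lambda_solution f D p l -> l = 0).

Definition extends_singletons (R : realType) (n : nat)
    (f : 'I_n -> fuzzy_set R) (D : defuzzification R) (p lambda : R)
    (mu : {set 'I_n} -> R) : Prop :=
  (forall i : 'I_n, mu [set i]%SET = mu_singleton f D p i) /\
  sugeno_rule lambda mu.

(* Definite description: the unique set function with the prescribed singleton
   values that satisfies the rule. The default value, the zero function, is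
   not a fuzzy measure. *)
Definition mu_fp (R : realType) (n : nat) (f : 'I_n -> fuzzy_set R)
    (D : defuzzification R) (p lambda : R) : {set 'I_n} -> R :=
  xget (fun=> 0) [set mu | unique (extends_singletons f D p lambda) mu].

(* Main.v *)
(* Writing w_i for the singleton values, the only set function compatible with a
   nonzero parameter l is mu(M) = (\prod_(i in M) (1 + l * w_i) - 1) / l; it is
   monotone because 1 + l * mu(M) > 0, and mu(V) = 1 is the equation defining l.
   The parameter 0 would give mu(V) = p < 1, so it has to be excluded: the
   polynomial \prod_i (1 + x * w_i) - (x + 1) is negative for small x > 0, since
   its slope at 0 is p - 1 < 0, and nonnegative for large x, since n >= 2. Hence
   it has a positive root. *)
Require Import Defs.
From HB Require Import structures.
From mathcomp Require Import all_boot all_order all_algebra.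
From mathcomp Require Import all_classical all_reals interval_inference.
From mathcomp Require Import ring lra.

Import Order.TTheory GRing.Theory Num.Theory.
Local Open Scope classical_set_scope.
Local Open Scope ring_scope.

(** Bounds the product near 0 without derivatives. With [S] the sum over the tail,
    [(1 + x * w i) * (1 - x * (w i + S))] is [1 - x * S] minus the nonnegative term
    [x * w i * (x * (w i + S))], so a new index cannot increase the left side. *)
Lemma prod_1D_mul_1Bsum_le1 (R : realDomainType) (I : Type) (s : seq I)
    (w : I -> R) (x : R) :
  0 <= x -> (forall i, 0 <= w i) ->
  (\prod_(i <- s) (1 + x * w i)) * (1 - x * \sum_(i <- s) w i) <= 1.
Proof.
move=> x0 w0; elim: s => [|i s IHs]; first by rewrite !big_nil; lra.
rewrite !big_cons; apply: le_trans IHs.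
have P0 : 0 <= \prod_(j <- s) (1 + x * w j).
  by apply: prodr_ge0 => j _; rewrite addr_ge0 ?mulr_ge0.
have S0 : 0 <= \sum_(j <- s) w j by apply: sumr_ge0.
rewrite mulrAC mulrC ler_wpM2l //.
have : 0 <= (x * w i) * (x * (w i + \sum_(j <- s) w j)).
  by rewrite !mulr_ge0 ?addr_ge0.
by rewrite !mulrDr; nra.
Qed.

Lemma exists_positive_parameter (R : rcfType) (n : nat) (w : 'I_n -> R) :
  (2 <= n)%N -> (forall i, 0 < w i) -> \sum_i w i < 1 ->
  exists2 l : R, 0 < l & l + 1 = \prod_i (1 + l * w i).
Proof.
case: n w => [|[|n]] // w _ w0; set S := \sum_i _ => S1.
pose P : {poly R} := \prod_i (1 + w i *: 'X) - ('X + 1).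
have PE x : P.[x] = \prod_i (1 + x * w i) - (x + 1).
  rewrite !hornerE horner_prod; congr (_ - _).
  by apply: eq_bigr => i _; rewrite !hornerE mulrC.
have S0 : 0 < S.
  by rewrite /S big_ord_recl ltr_pwDl // sumr_ge0 // => i _; exact: ltW.
(* As [1 - S] is twice [a], the product [(a + 1) * (1 - a * S)] exceeds 1 by [a * a * (2 - S)],
   which is enough to give [P.[a] <= 0]. *)
pose a := (1 - S) / 2%:R.
have a0 : 0 < a by rewrite /a; lra.
have aP : P.[a] <= 0.
  rewrite PE subr_le0.
  have le1 := @prod_1D_mul_1Bsum_le1 _ _ (index_enum 'I_n.+2) _ _ (ltW a0)
    (fun i => ltW (w0 i)).
  rewrite -/S in le1.
  have Sa : 0 < 1 - a * S by rewrite /a; nra.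
  rewrite -(ler_pM2r Sa); apply: le_trans le1 _.
  have -> : (a + 1) * (1 - a * S) = 1 + a * a * (2%:R - S) by rewrite /a; field.
  by rewrite lerDl !mulr_ge0 ?(ltW a0) //; lra.
pose j : 'I_n.+2 := lift ord0 ord0.
have w01 : 0 < w ord0 * w j by rewrite mulr_gt0.
have ww1 : w ord0 * w j < 1.
  have : w ord0 + w j <= S.
    by rewrite /S !big_ord_recl addrA lerDl sumr_ge0 // => i _; exact: ltW.
  by have := w0 ord0; have := w0 j; nra.
(* This makes the cross term [b * b * (w ord0 * w j)] equal to [b], so two factors alone reach
   [1 + b]; the others are at least 1. *)
pose b := (w ord0 * w j)^-1.
have b0 : 0 < b by rewrite invr_gt0.
have ab : a <= b.
  apply: (@le_trans _ _ 1); first by rewrite /a; lra.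
  by rewrite invf_ge1 // ltW.
have bP : 0 <= P.[b].
  rewrite PE subr_ge0 !big_ord_recl -/j mulrA.
  have bww : b * (w ord0 * w j) = 1 by rewrite mulVf ?gt_eqF.
  have ge1 : 1 <= \prod_(i < n) (1 + b * w (lift ord0 (lift ord0 i))).
    elim/big_ind: _ => // [x y|i _]; last by rewrite lerDl mulr_ge0 // ltW.
    exact: mulr_ege1.
  apply: (@le_trans _ _ ((1 + b * w ord0) * (1 + b * w j))); last first.
    by rewrite ler_peMr // mulr_ge0 // addr_ge0 // mulr_ge0 // ltW.
  have -> : (1 + b * w ord0) * (1 + b * w j) =
      1 + b * w ord0 + b * w j + b * (b * (w ord0 * w j)) by ring.
  rewrite bww mulr1.
  have := mulr_gt0 b0 (w0 ord0); have := mulr_gt0 b0 (w0 j); lra.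
(* Starting the interval at [a > 0] keeps out the trivial root 0. *)
have [|x /andP[ax _] /rootP] := @poly_ivt R P a b ab; first by rewrite aP.
rewrite PE => /eqP; rewrite subr_eq0 => /eqP Px.
by exists x => //; exact: lt_le_trans ax.
Qed.

Lemma finset_ind (T : finType) (P : {set T} -> Prop) :
  P finset.set0 -> (forall x (A : {set T}), x \notin A -> P A -> P (x |: A)%SET) ->
  forall A, P A.
Proof.
move=> P0 PU A; elim: {A}#|A| {-2}A (erefl #|A|) => [A /eqP|k IHk A Ak].
  by rewrite cards_eq0 => /eqP ->.
have /card_gt0P[x xA] : (0 < #|A|)%N by rewrite Ak.
rewrite -(finset.setD1K xA); apply: PU; first by rewrite !inE eqxx.
by apply: IHk; move: Ak; rewrite (cardsD1 x) xA add1n => -[].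
Qed.

(** The rule for [[set i]] and the empty set reads [mu set0 * (1 + l * mu [set i]) = 0]. *)
Lemma sugeno_rule_set0 (R : realType) (n : nat) (l : R) (mu : {set 'I_n} -> R)
    (i : 'I_n) :
  sugeno_rule l mu -> 0 < 1 + l * mu [set i]%SET -> mu finset.set0 = 0.
Proof.
move=> rule pos; have := rule [set i]%SET finset.set0 (finset.setI0 _).
rewrite finset.setU0 => /eqP; rewrite -addrA eq_sym -subr_eq0 addrAC subrr add0r.
rewrite -{1}[mu finset.set0]mul1r -mulrDl mulf_eq0 gt_eqF //=.
by move/eqP.
Qed.

Lemma sugeno_rule_inj (R : realType) (n : nat) (l : R)
    (mu nu : {set 'I_n} -> R) :
  sugeno_rule l mu -> sugeno_rule l nu ->
  mu finset.set0 = nu finset.set0 ->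
  (forall i, mu [set i]%SET = nu [set i]%SET) -> mu = nu.
Proof.
move=> rmu rnu e0 e1; apply/funext => M.
elim/finset_ind: M => [//|i M iM IHM].
have dis : [set i]%SET :&: M = finset.set0.
  by apply/eqP; rewrite finset.setI_eq0 disjoints1.
by rewrite rmu // rnu // IHM e1.
Qed.

Definition prod_measure (R : realType) (n : nat) (w : 'I_n -> R) (l : R)
    (M : {set 'I_n}) : R :=
  (\prod_(i in M) (1 + l * w i) - 1) / l.
Arguments prod_measure {R n} w l M.

Section ProdMeasure.
Variables (R : realType) (n : nat) (w : 'I_n -> R) (l : R).
Hypothesis l0 : l != 0.

Lemma prod_measureK (M : {set 'I_n}) :
  1 + l * prod_measure w l M = \prod_(i in M) (1 + l * w i).
Proof. by rewrite /prod_measure mulrC divfK // addrC subrK. Qed.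

Lemma prod_measure0 : prod_measure w l finset.set0 = 0.
Proof. by rewrite /prod_measure big_set0 subrr mul0r. Qed.

Lemma prod_measure1 (i : 'I_n) : prod_measure w l [set i]%SET = w i.
Proof. by rewrite /prod_measure big_set1 addrC addKr mulrC mulKf. Qed.

(** For the products [P] over [M] and [Q] over [N], this is [P * Q - 1 = (P - 1) + (Q - 1) + (P - 1)
    * (Q - 1)] divided by [l]. *)
Lemma prod_measure_rule : sugeno_rule l (prod_measure w l).
Proof.
move=> M N MN0.
have dis : [disjoint M & N]%B by rewrite -finset.setI_eq0 MN0.
have -> : prod_measure w l (M :|: N)%SET =
    ((\prod_(i in M) (1 + l * w i)) * \prod_(i in N) (1 + l * w i) - 1) / l.
  rewrite /prod_measure -bigU //=; congr ((_ - 1) / l).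
  by apply: eq_bigl => i; rewrite !inE.
by rewrite /prod_measure; field.
Qed.

Hypothesis w0 : forall i, 0 <= w i.
Hypothesis lw0 : forall i, 0 < 1 + l * w i.

(** Adding a point [i] to [M] gives [w i + (1 + l * w i) * prod_measure w l M]; induction thus
    avoids a case split on the sign of [l]. *)
Lemma prod_measure_ge0 (M : {set 'I_n}) : 0 <= prod_measure w l M.
Proof.
elim/finset_ind: M => [|i M iM IHM]; first by rewrite prod_measure0.
rewrite prod_measure_rule; last first.
  by apply/eqP; rewrite finset.setI_eq0 disjoints1.
rewrite prod_measure1 -addrA -[X in _ + (X + _)]mul1r -mulrDl.
by rewrite addr_ge0 // mulr_ge0 // ltW.
Qed.

Lemma prod_measure_mono (M N : {set 'I_n}) :
  M \subset N -> prod_measure w l M <= prod_measure w l N.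
Proof.
move=> /finset.setIidPr MN.
rewrite -(finset.setID N M) MN prod_measure_rule; last first.
  by rewrite finset.setIDA finset.setIC finset.setDIl finset.setDv finset.setI0.
(* The increment is [1 + l * prod_measure w l M], a product of positive factors, times the value at
   [N :\: M]. *)
rewrite -addrA lerDl -[X in X + _]mul1r -mulrDl prod_measureK.
by rewrite mulr_ge0 ?prod_measure_ge0 // prodr_ge0 // => i _; exact: ltW.
Qed.

Lemma prod_measure_fuzzy :
  l + 1 = \prod_i (1 + l * w i) -> fuzzy_measure (prod_measure w l).
Proof.
move=> le.
have T1 : prod_measure w l [set: 'I_n]%SET = 1.
  rewrite /prod_measure (eq_bigl xpredT); last by move=> i; rewrite !inE.
  by rewrite -le addrK divff.
split=> [M|||]; [|exact: prod_measure0|exact: T1|exact: prod_measure_mono].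
by rewrite prod_measure_ge0 -T1 prod_measure_mono // finset.subsetT.
Qed.

End ProdMeasure.

Theorem proposition2 (R : realType) (n : nat) (hn : (2 <= n)%N)
    (U : set {posnum R}) (eta : 'I_n -> U -> {i01 R})
    (D : defuzzification R) (p : R) (hp : 0 < p < 1)
    (lambda : R)
    (hlambda : sugeno_parameter (fun i => extend_fuzzy (eta i)) D p lambda) :
  sugeno_lambda_measure
    (mu_fp (fun i => extend_fuzzy (eta i)) D p lambda).
Proof.
move: hlambda; set f := (fun i => _) => -[[l1 leq] lz].
have /andP[p0 p1] := hp.
pose i0 : 'I_n := Ordinal (ltnW hn).
set w := mu_singleton f D p in leq.
have S0 : 0 < \sum_(k < n) (D (f k))%:num.
  by rewrite (bigD1 i0) //= ltr_pwDl // sumr_ge0.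
have w0 i : 0 < w i by rewrite /w /mu_singleton divr_gt0 // mulr_gt0.
have wS : \sum_i w i = p.
  by rewrite /w /mu_singleton -mulr_suml -mulr_sumr mulfK // gt_eqF.
have w1 i : w i < 1.
  apply: le_lt_trans p1; rewrite -wS (bigD1 i) //= lerDl sumr_ge0 // => j _.
  exact: ltW.
(* From [lambda > -1] and [0 < w i < 1] follows [lambda * w i > - w i > -1]. *)
have lw0 i : 0 < 1 + lambda * w i by have := w0 i; have := w1 i; nra.
have l0 : lambda != 0.
  apply/eqP => /lz nz.
  have [|l l_gt0 le] := @exists_positive_parameter R n w hn w0.
    by rewrite wS.
  by have := l_gt0; rewrite (nz l) ?ltxx //; split=> //; lra.
have ext : extends_singletons f D p lambda (prod_measure w lambda).
  by split=> [i|]; [rewrite prod_measure1|exact: prod_measure_rule].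
have uniq mu : extends_singletons f D p lambda mu -> prod_measure w lambda = mu.
  move=> [mu1 rmu].
  apply: (@sugeno_rule_inj _ _ _ _ _ (@prod_measure_rule _ _ _ _ l0) rmu).
    by rewrite prod_measure0 (@sugeno_rule_set0 _ _ lambda _ i0) // mu1.
  by move=> i; rewrite prod_measure1 // mu1.
have -> : mu_fp f D p lambda = prod_measure w lambda.
  rewrite /mu_fp.
  (* [uniq] identifies any function meeting the description; [ext] and [uniq] together rule out the
     default branch. *)
  by case: xgetP => [mu _ [/uniq]|/(_ (prod_measure w lambda))[]].
split; last by exists lambda; split=> //; exact: prod_measure_rule.
by apply: prod_measure_fuzzy => // i; exact: ltW.
Qed.
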